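(* Let $\mathbf g\simeq\mathbf C_r$ or $\mathbf g\simeq\mathbf D_r$, realized in its $2r$-dimensional typical representation with invariant matrix $S$ and group $\mathbf G$ (see context). Let $L_0=i\frac{d}{dx}+q_{(0)}(x,t)-\lambda J$ and $M_0=i\frac{d}{dt}+V(x,t,\lambda)$ be a Lax pair, let $\chi_0^\pm(x,t,\lambda)$ be its fundamental analytic solutions (FAS), and let $\lambda_1^+,\lambda_1^-\in\mathbb C$ with $\operatorname{Im}\lambda_1^+>0$, $\operatorname{Im}\lambda_1^-<0$. Let $n_0^1,\dots,n_0^r,m_0^1,\dots,m_0^r\in\mathbb C^{2r}$ be constant column vectors with $$(m_0^i)^TS\,m_0^k=(n_0^i)^TS\,n_0^k=0\qquad(1\le i,k\le r).$$ Let $R(x,t)$ be the $r\times r$ matrix with entries $$R_{ik}(x,t)=(m_0^i)^T\bigl(\chi_0^-(x,t,\lambda_1^-)\bigr)^{-1}\chi_0^+(x,t,\lambda_1^+)\,n_0^k ,$$ and on the open set of $(x,t)$ where $\det R\neq0$ define $$\pi_1(x,t)=\sum_{i,k=1}^r\chi_0^+(x,t,\lambda_1^+)\,n_0^i\,(R^{-1})_{ik}\,(m_0^k)^T\bigl(\chi_0^-(x,t,\lambda_1^-)\bigr)^{-1},\qquad \pi_{-1}=S\pi_1^TS^{-1}.$$ Then on this set $\pi_1$ and $\pi_{-1}$ are mutually orthogonal projectors of rank $r$ ($\pi_{\pm1}^2=\pi_{\pm1}$, $\pi_1\pi_{-1}=\pi_{-1}\pi_1=0$) with $\pi_1+\pi_{-1}=\mathbf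 1$, and they define a dressing factor with exponent $\mu=\tfrac12$. That is, with $$q_{(1)}=q_{(0)}+(\lambda_1^--\lambda_1^+)[J,\pi_1],$$ $$u(x,t,\lambda)=\mathbf 1+(c(\lambda)-1)\pi_1(x,t)+(c(\lambda)^{-1}-1)\pi_{-1}(x,t),\qquad c(\lambda)=\Bigl(\frac{\lambda-\lambda_1^+}{\lambda-\lambda_1^-}\Bigr)^{1/2}$$ (the branch of the square root on the complement of the segment joining $\lambda_1^+$ and $\lambda_1^-$ with $c(\lambda)\to1$ as $\lambda\to\infty$), one has $u(x,t,\lambda)\in\mathbf G$, i.e. $u^{-1}=Su^TS^{-1}$, and $$i\frac{\partial u}{\partial x}+q_{(1)}\,u-u\,q_{(0)}-\lambda[J,u]=0$$ for all $\lambda$ off that segment.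
   Context: All matrices are complex $N\times N$ with $N=2r$; $E_{kn}$ is the matrix unit $(E_{kn})_{ij}=\delta_{ik}\delta_{nj}$; $\bar k=N+1-k$. The matrix $S$ is $$S=\sum_{k=1}^r(-1)^{k+1}(E_{k\bar k}-E_{\bar kk})\ \text{ for }\mathbf C_r\ (S^{-1}=S^T=-S),\qquad S=\sum_{k=1}^r(-1)^{k+1}(E_{k\bar k}+E_{\bar kk})\ \text{ for }\mathbf D_r\ (S^{-1}=S^T=S).$$ The group is $\mathbf G=\{g:g^{-1}=Sg^TS^{-1}\}$, with Lie algebra $\mathbf g=\{X:X+SX^TS^{-1}=0\}$ and Cartan subalgebra $\mathbf h$ of diagonal matrices in $\mathbf g$, spanned by $H_{e_k}=E_{kk}-E_{\bar k\bar k}$, $k=1,\dots,r$. Standing assumptions. $J=\sum_kJ_kH_{e_k}\in\mathbf h$ is real, constant and regular: $\alpha(J)>0$ for every positive root $\alpha$. The potential $q_{(0)}(x,t)$ takes values in $\mathbf g/\mathbf h$, i.e. in the span of the root vectors of $\mathbf g$ (zero Cartan component), is smooth and for each $t$ is a Schwartz-type function of $x$. Moreover $V(x,t,\lambda)=\sum_{k=0}^{P-1}V_k(x,t)\lambda^k-f_P\lambda^PI$ with $V_k\in\mathbf g$, $I\in\mathbf h$ a real constant element, $f_P$ a constant, and $[L_0,M_0]=0$ identically in $\lambda$. Fundamental analytic solutions. For real $\lambda$ let $\phi,\psi$ be the solutions of $L_0\phi=L_0\psi=0$ with $e^{i\lambda Jx}\phi\to\mathbf 1$ as $x\to-\infty$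 and $e^{i\lambda Jx}\psi\to\mathbf 1$ as $x\to+\infty$; the scattering matrix is $T=\psi^{-1}\phi$, with Gauss decompositions $T=T^-D^+(S^+)^{-1}=T^+D^-(S^-)^{-1}$, where $S^\pm,T^\pm$ are exponentials of elements in the span of the root vectors $E_{\pm\alpha}$, $\alpha>0$, and $D^\pm$ are in the Cartan subgroup. The FAS of $L_0$ are the $\mathbf G$-valued solutions $\chi_0^\pm$ of $i\partial_x\chi+(q_{(0)}-\lambda J)\chi=0$, analytic in $\lambda$ for $\pm\operatorname{Im}\lambda>0$, with (on the real axis) $e^{i\lambda Jx}\chi_0^\pm\to S^\pm(\lambda)$ as $x\to-\infty$ and $e^{i\lambda Jx}\chi_0^\pm\to T^\mp(\lambda)D^\pm(\lambda)$ as $x\to+\infty$. The FAS of the Lax pair $L_0,M_0$ are these solutions multiplied on the right by $\exp(-if_P\lambda^PIt)$, so that they also satisfy $i\partial_t\chi+V\chi=0$; for example, if $q_{(0)}=0$ and $V=-\lambda I$ then $\chi_0^\pm=\exp(-i\lambda(Jx+It))$. *)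

(* Defs.v *)
From HB Require Import structures.
From mathcomp Require Import all_boot all_order all_algebra.
From mathcomp Require Import complex.
From mathcomp Require Import all_classical all_reals all_analysis.
Set Implicit Arguments.
Unset Strict Implicit.
Unset Printing Implicit Defensive.
Import Order.TTheory GRing.Theory Num.Theory.
Import numFieldNormedType.Exports.
Local Open Scope classical_set_scope.
Local Open Scope ring_scope.
Local Open Scope complex_scope.

(* The alias R[i]^o carries the topology of the modulus, which R[i] lacks. *)

Section Calculus.
Context {R : realType} {n : nat}.
Implicit Types f : R -> 'M[R[i]]_n.

Definition mxcvg (F : set_system R) f (l : 'M[R[i]]_n) : Prop :=
  forall i j, (f x i j : R[i]^o) @[x --> F] --> (l i j : R[i]^o).

Definition mxderivable f (x : R) : Prop :=
  forall i j, derivable (fun y : R => complex.Re (f y i j) : R) x 1 /\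
              derivable (fun y : R => complex.Im (f y i j) : R) x 1.

Definition mxD f (x : R) : 'M[R[i]]_n :=
  \matrix_(i, j) (derive1 (fun y : R => complex.Re (f y i j) : R) x
                  +i* derive1 (fun y : R => complex.Im (f y i j) : R) x).

Definition expm (X : 'M[R[i]]_n) : 'M[R[i]]_n :=
  \matrix_(i, j)
    lim ((fun m : nat =>
            (\sum_(k < m) (k`!%:R^-1 *: X ^+ k)) i j : R[i]^o) @ \oo).

Definition mxcomm (A B : 'M[R[i]]_n) : 'M[R[i]]_n := A *m B - B *m A.

(* D a b is the mixed partial derivative of order a in x and b in t. *)
Definition smooth_schwartz (q : R -> R -> 'M[R[i]]_n) : Prop :=
  exists D : nat -> nat -> R -> R -> 'M[R[i]]_n,
  [/\ forall x t, D 0 0 x t = q x t,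
      forall a b x t, mxderivable (fun y => D a b y t) x /\
                      mxD (fun y => D a b y t) x = D a.+1 b x t,
      forall a b x t, mxderivable (fun s => D a b x s) t /\
                      mxD (fun s => D a b x s) t = D a b.+1 x t,
      forall a b i j,
        continuous (fun p : R * R => D a b p.1 p.2 i j : R[i]^o)
    & forall (t : R) (a m : nat), exists C : R, forall x i j,
        (`|x| ^+ m)%:C * `|D a 0 x t i j| <= C%:C].

End Calculus.

Inductive lie_series := C_series | D_series.

Section Algebra.
Context {R : realType}.
Variables (ty : lie_series) (r : nat).
Notation M := 'M[R[i]]_(r + r).

(* Indices start from 0: lo k is the k-th of the first r indices, k < r, and
   hi k is its mirror image k |-> N - 1 - k, where N = 2r. *)
Definition lo (k : 'I_r) : 'I_(r + r) := lshift r k.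
Definition hi (k : 'I_r) : 'I_(r + r) := rev_ord (lo k).

Definition Smx : M :=
  \sum_(k < r) (-1) ^+ k *:
    match ty with
    | C_series => delta_mx (lo k) (hi k) - delta_mx (hi k) (lo k)
    | D_series => delta_mx (lo k) (hi k) + delta_mx (hi k) (lo k)
    end.

(* invmx g is g itself when g is singular, hence the first conjunct. *)
Definition in_group (g : M) : Prop :=
  g \in unitmx /\ invmx g = Smx *m g^T *m invmx Smx.

Definition in_algebra (X : M) : Prop := X + Smx *m X^T *m invmx Smx = 0.

Definition in_cartan (H : M) : Prop := in_algebra H /\ is_diag_mx H.

(* The Cartan subgroup: the diagonal elements of the group. *)
Definition in_cartan_group (g : M) : Prop := in_group g /\ is_diag_mx g.

Definition Hbasis (k : 'I_r) : M :=
  delta_mx (lo k) (lo k) - delta_mx (hi k) (hi k).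

Definition cartan_elt (a : 'I_r -> R) : M := \sum_k (a k)%:C *: Hbasis k.

(* A root is the row of its integer coordinates in the basis e_1, ..., e_r of
   the dual of the Cartan subalgebra dual to the basis Hbasis. *)
Definition e_ (k : 'I_r) : 'rV[int]_r := delta_mx 0 k.

Definition pos_root (alpha : 'rV[int]_r) : Prop :=
  (exists i j : 'I_r, (i < j)%N /\
     (alpha = e_ i - e_ j \/ alpha = e_ i + e_ j))
  \/ (ty = C_series /\ exists i : 'I_r, alpha = e_ i *+ 2).

Definition neg_root (alpha : 'rV[int]_r) : Prop := pos_root (- alpha).

Definition root_eval (alpha : 'rV[int]_r) (H : M) : R[i] :=
  \sum_k (alpha 0 k)%:~R * H (lo k) (lo k).

(* On R[i], 0 < z says that z is real and positive. *)
Definition regular (H : M) : Prop :=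
  forall alpha, pos_root alpha -> 0 < root_eval alpha H.

Definition root_vector (alpha : 'rV[int]_r) (X : M) : Prop :=
  in_algebra X /\
  forall H, in_cartan H -> mxcomm H X = root_eval alpha H *: X.

Definition root_span (P : 'rV[int]_r -> Prop) (X : M) : Prop :=
  exists s : seq M,
    (forall Y, Y \in s -> exists2 alpha, P alpha & root_vector alpha Y) /\
    X = \sum_(Y <- s) Y.

End Algebra.

Section LaxPair.
Context {R : realType}.
Variables (ty : lie_series) (r : nat).
Notation M := 'M[R[i]]_(r + r).
Implicit Types (q : R -> R -> M) (J I : M) (chi chip chim : R -> R -> R[i] -> M).

Definition solves_L0 q J (t : R) (z : R[i]) (f : R -> M) : Prop :=
  forall x, mxderivable f x /\
            'i%C *: mxD f x + (q x t - z *: J) *m f x = 0.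

Definition Vpot (P : nat) (Vk : 'I_P -> R -> R -> M) (fP : R[i]) I
    (x t : R) (z : R[i]) : M :=
  \sum_(k < P) z ^+ k *: Vk k x t - (fP * z ^+ P) *: I.

(* The commutator of i d/dx + U and i d/dt + V is the operator of
   multiplication by i V_x - i U_t + [U, V]; here U = q - z J. *)
Definition lax_compatible q J (P : nat) (Vk : 'I_P -> R -> R -> M)
    (fP : R[i]) I : Prop :=
  (forall k x t, mxderivable (fun y => Vk k y t) x) /\
  (forall x t z,
     'i%C *: mxD (fun y => Vpot Vk fP I y t z) x
     - 'i%C *: mxD (fun s => q x s - z *: J) t
     + mxcomm (q x t - z *: J) (Vpot Vk fP I x t z) = 0).

(* The factors of the two Gauss decompositions of the scattering matrix T at
   time t and real spectral parameter l. *)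
Definition scattering_data q J (t l : R) (Sp Sm Tp Tm Dp Dm : M) : Prop :=
  exists (phi psi : R -> M) (T : M),
  [/\ solves_L0 q J t l%:C phi /\
      mxcvg -oo%R (fun x => expm (('i%C * (l * x)%:C) *: J) *m phi x) 1%:M,
      solves_L0 q J t l%:C psi /\
      mxcvg +oo%R (fun x => expm (('i%C * (l * x)%:C) *: J) *m psi x) 1%:M,
      forall x, T = invmx (psi x) *m phi x,
      [/\ T = Tm *m Dp *m invmx Sp, T = Tp *m Dm *m invmx Sm,
          in_cartan_group ty Dp & in_cartan_group ty Dm]
    & [/\ exists2 X, root_span ty (@pos_root ty r) X & Sp = expm X,
          exists2 X, root_span ty (@pos_root ty r) X & Tp = expm X,
          exists2 X, root_span ty (@neg_root ty r) X & Sm = expm X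
        & exists2 X, root_span ty (@neg_root ty r) X & Tm = expm X]].

(* Solutions on the closed half-plane 0 <= s * Im z (s = 1 or -1), analytic in
   its interior and with their boundary values on the real axis. *)
Definition L0_half_plane_solution q J (s : R) chi : Prop :=
  [/\ forall x t z, 0 <= s * complex.Im z -> in_group ty (chi x t z),
      forall t z, 0 <= s * complex.Im z -> solves_L0 q J t z (chi ^~ t ^~ z),
      forall x t i j (z : R[i]^o), 0 < s * complex.Im z ->
        derivable (fun w : R[i]^o => chi x t w i j : R[i]^o) z 1
    & forall x t i j,
        {within [set z : R[i]^o | 0 <= s * complex.Im z],
          continuous (fun w : R[i]^o => chi x t w i j : R[i]^o)}].

Definition L0_FAS q J chip chim : Prop :=
  [/\ L0_half_plane_solution q J 1 chip,
      L0_half_plane_solution q J (-1) chim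
    & forall t l : R, exists Sp Sm Tp Tm Dp Dm : M,
      let E x := expm (('i%C * (l * x)%:C) *: J) in
      [/\ scattering_data q J t l Sp Sm Tp Tm Dp Dm,
          mxcvg -oo%R (fun x => E x *m chip x t l%:C) Sp /\
          mxcvg +oo%R (fun x => E x *m chip x t l%:C) (Tm *m Dp)
        & mxcvg -oo%R (fun x => E x *m chim x t l%:C) Sm /\
          mxcvg +oo%R (fun x => E x *m chim x t l%:C) (Tp *m Dm)]].

Definition lax_FAS q J (P : nat) (Vk : 'I_P -> R -> R -> M) (fP : R[i]) I
    chip chim : Prop :=
  let E t z := expm ((- 'i%C * fP * z ^+ P * t%:C) *: I) in
  let solves_M0 chi x t z :=
    mxderivable (chi x ^~ z) t /\
    'i%C *: mxD (chi x ^~ z) t + Vpot Vk fP I x t z *m chi x t z = 0 in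
  exists chip0 chim0,
  [/\ L0_FAS q J chip0 chim0,
      forall x t z, 0 <= complex.Im z ->
        chip x t z = chip0 x t z *m E t z /\ solves_M0 chip x t z
    & forall x t z, complex.Im z <= 0 ->
        chim x t z = chim0 x t z *m E t z /\ solves_M0 chim x t z].

End LaxPair.

Section Dressing.
Context {R : realType}.
Variables (ty : lie_series) (r : nat).
Notation M := 'M[R[i]]_(r + r).
Variables (q : R -> R -> M) (J : M) (chip chim : R -> R -> R[i] -> M).
Variables (lp lm : R[i]) (n0 m0 : 'I_r -> 'cV[R[i]]_(r + r)).

Definition Rmx (x t : R) : 'M[R[i]]_r :=
  \matrix_(i, k)
    ((m0 i)^T *m invmx (chim x t lm) *m chip x t lp *m n0 k) 0 0.

Definition pi1 (x t : R) : M :=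
  \sum_(i < r) \sum_(k < r)
    invmx (Rmx x t) i k *:
      (chip x t lp *m n0 i *m (m0 k)^T *m invmx (chim x t lm)).

Definition pim1 (x t : R) : M :=
  Smx ty r *m (pi1 x t)^T *m invmx (Smx ty r).

Definition q1 (x t : R) : M := q x t + (lm - lp) *: mxcomm J (pi1 x t).

Definition dressing (c : R[i] -> R[i]) (x t : R) (z : R[i]) : M :=
  1%:M + (c z - 1) *: pi1 x t + ((c z)^-1 - 1) *: pim1 x t.

Definition on_segment (z : R[i]) : Prop :=
  exists2 s : R, 0 <= s <= 1 & z = lm + s%:C * (lp - lm).

Definition sqrt_branch (c : R[i] -> R[i]) : Prop :=
  [/\ forall z, ~ on_segment z -> c z ^+ 2 = (z - lp) / (z - lm),
      forall z : R[i]^o, ~ on_segment z ->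
        {for z, continuous (c : R[i]^o -> R[i]^o)}
    & forall e : R, 0 < e -> exists B : R, forall z,
        ~ on_segment z -> B%:C < `|z| -> `|c z - 1| < e%:C].

End Dressing.

(* Main.v *)
(* Write n = chi+(lp) n0, m^T = m0^T chi-(lm)^-1, so that R = m^T n and
   pi1 = n R^-1 m^T.  The t-equation with V in the Lie algebra keeps
   chi^T S^-1 chi constant in t, and at t = 0 the factor exp(-i f_P z^P I t) is
   1; hence chi+(lp) and chi-(lm) are in G and n, m remain isotropic.
   Isotropy says that the rows of [R^-1 m^T; R^-T n^T S^-1] are dual to the
   columns of [n, S m], and the product in the other order gives
   pi1 + pi_{-1} = 1.  The x-equations yield
     i pi_x = pi (q - lm J) - (q - lp J) pi + (lm - lp) pi J pi,
   and since u = c^-1 + (c - c^-1) pi near every point where det R <> 0, the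
   equation for u reduces to c^-1 (lm - lp) = (c - c^-1) (z - lm), which is the
   defining relation of c^2. *)
Require Import Defs.
From HB Require Import structures.
From mathcomp Require Import all_boot all_order all_algebra.
From mathcomp Require Import complex ring zify.
From mathcomp Require Import all_classical all_reals all_analysis.
Set Implicit Arguments.
Unset Strict Implicit.
Unset Printing Implicit Defensive.
Import Order.TTheory GRing.Theory Num.Theory.
Import numFieldNormedType.Exports.
Local Open Scope ring_scope.
Local Open Scope complex_scope.

(** * Derivatives of complex-valued functions of one real variable *)

Section ComplexDerivative.
Context {R : realType}.
Implicit Types f g : R -> R[i].

(** Splitting into real and imaginary parts agrees with [mxderivable] and [mxD], and lets the real
    rules of differentiation apply to each part. *)
Definition is_cderive f (x : R) (d : R[i]) : Prop :=
  is_derive x 1 (fun y : R => complex.Re (f y) : R) (complex.Re d) /\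
  is_derive x 1 (fun y : R => complex.Im (f y) : R) (complex.Im d).

Lemma is_cderive_cst (a : R[i]) x : is_cderive (fun=> a) x 0.
Proof. by split; exact: is_derive_cst. Qed.

Lemma is_cderiveD f g x a b :
  is_cderive f x a -> is_cderive g x b ->
  is_cderive (fun y => f y + g y) x (a + b).
Proof.
move=> [fr fi] [gr gi]; split; rewrite raddfD.
  by under eq_fun do rewrite raddfD; exact: is_deriveD.
by under eq_fun do rewrite raddfD; exact: is_deriveD.
Qed.

Lemma ReM (z w : R[i]) : complex.Re (z * w) =
  complex.Re z * complex.Re w - complex.Im z * complex.Im w.
Proof. by case: z w => [a b] [c d]. Qed.

Lemma ImM (z w : R[i]) : complex.Im (z * w) =
  complex.Re z * complex.Im w + complex.Im z * complex.Re w.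
Proof. by case: z w => [a b] [c d]. Qed.

Lemma is_cderiveM f g x a b :
  is_cderive f x a -> is_cderive g x b ->
  is_cderive (fun y => f y * g y) x (a * g x + f x * b).
Proof.
move=> [fr fi] [gr gi]; split; rewrite raddfD /= ?ReM ?ImM.
- under eq_fun do rewrite ReM.
  apply: (is_derive_eq (is_deriveB (is_deriveM fr gr) (is_deriveM fi gi))).
  by rewrite /GRing.scale /=; ring.
- under eq_fun do rewrite ImM.
  apply: (is_derive_eq (is_deriveD (is_deriveM fr gi) (is_deriveM fi gr))).
  by rewrite /GRing.scale /=; ring.
Qed.

(** The squared modulus, taken in [R] and free of square roots, so that it is a differentiable real
    denominator for inverses. *)
Definition sqnormc (z : R[i]) : R := complex.Re z ^+ 2 + complex.Im z ^+ 2.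

Lemma sqnormc_eq0 z : (sqnormc z == 0) = (z == 0).
Proof.
by case: z => a b; rewrite /sqnormc eq_complex /= paddr_eq0 ?sqr_ge0 // !sqrf_eq0.
Qed.

Lemma is_derive_sqnormc f x a : is_cderive f x a ->
  is_derive x 1 (fun y : R => sqnormc (f y) : R)
    (2 * (complex.Re (f x) * complex.Re a + complex.Im (f x) * complex.Im a)).
Proof.
move=> [fr fi]; rewrite /sqnormc.
apply: (is_derive_eq (is_deriveD (is_deriveM fr fr) (is_deriveM fi fi))).
by rewrite /GRing.scale /=; ring.
Qed.

(** The inverse is the conjugate divided by the squared modulus; each component is then a real
    quotient. *)
Lemma is_cderiveV f x a : f x != 0 -> is_cderive f x a ->
  is_cderive (fun y => (f y)^-1) x (- ((f x)^-1 ^+ 2 * a)).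
Proof.
move=> f0 fa; have n0 : sqnormc (f x) != 0 by rewrite sqnormc_eq0.
have dn := @is_deriveV _ (fun y => sqnormc (f y)) _ _ _ n0 (is_derive_sqnormc fa).
have VE (z : R[i]) : z^-1 =
    (complex.Re z * (sqnormc z)^-1) +i* (- (complex.Im z * (sqnormc z)^-1)).
  by case: z.
case: fa => fr fi; move: n0 dn; rewrite VE.
set n := sqnormc (f x) => n0 dn.
have nE : n = complex.Re (f x) ^+ 2 + complex.Im (f x) ^+ 2 by [].
split.
- under eq_fun do rewrite VE.
  apply: (is_derive_eq (is_deriveM fr dn)).
  rewrite /GRing.scale /= -/n; case: a fr fi dn => ar ai /= _ _ _.
  move: n0; rewrite nE.
  case: (f x) => u v /= n0; field.
  by rewrite n0.
- under eq_fun do rewrite VE.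
  apply: (is_derive_eq (is_deriveN (is_deriveM fi dn))).
  rewrite /GRing.scale /= -/n; case: a fr fi dn => ar ai /= _ _ _.
  move: n0; rewrite nE.
  case: (f x) => u v /= n0; field.
  by rewrite n0.
Qed.

(** The squared modulus is differentiable, hence continuous. Applied to determinants, this makes
    invertibility at a point persist nearby. *)
Lemma is_cderive_near_neq0 f x a : f x != 0 -> is_cderive f x a ->
  \forall y \near x, f y != 0.
Proof.
move=> f0 /is_derive_sqnormc [/derivable1_diffP/differentiable_continuous fc _].
have : \forall y \near x, sqnormc (f y) != 0.
  by apply: (fc (fun r => r != 0)); apply: open_nbhs_nbhs; split;
    [exact: open_neq|rewrite /= sqnormc_eq0].
by apply: filterS => y; rewrite sqnormc_eq0.
Qed.

Lemma near_eq_is_cderive f g x a : (\forall y \near x, f y = g y) ->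
  is_cderive f x a -> is_cderive g x a.
Proof.
move=> fg [fr fi]; split; [move: fr|move: fi]; apply: near_eq_is_derive;
  by apply: filterS fg => y ->.
Qed.

Lemma is_cderive_unique f x a b :
  is_cderive f x a -> is_cderive f x b -> a = b.
Proof.
move=> [[_ ra] [_ ia]] [[_ rb] [_ ib]].
by case: a b ra rb ia ib => [? ?] [? ?] /= <- <- <- <-.
Qed.

Lemma is_cderive_sum (I : Type) (s : seq I) (P : pred I) (f : I -> R -> R[i]) x d :
  (forall i, is_cderive (f i) x (d i)) ->
  is_cderive (fun y => \sum_(i <- s | P i) f i y) x (\sum_(i <- s | P i) d i).
Proof.
move=> df; elim: s => [|i s IHs].
  by under eq_fun do rewrite big_nil; rewrite big_nil; exact: is_cderive_cst.
under eq_fun do rewrite big_cons; rewrite big_cons.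
by case: (P i) => //; apply: is_cderiveD.
Qed.

Lemma is_cderive0_cst f : (forall x, is_cderive f x 0) -> forall x y, f x = f y.
Proof.
move=> f0 x y.
have rE := @is_derive_0_is_cst R (fun z => complex.Re (f z)) x y (fun z => (f0 z).1).
have iE := @is_derive_0_is_cst R (fun z => complex.Im (f z)) x y (fun z => (f0 z).2).
by move: rE iE; case: (f x) (f y) => [? ?] [? ?] /= -> ->.
Qed.

End ComplexDerivative.

(** * Entrywise derivatives of matrix-valued functions, including the inverse *)

Section MatrixDerivative.
Context {R : realType}.

Definition is_mxderive m n (f : R -> 'M[R[i]]_(m, n)) (x : R) (d : 'M[R[i]]_(m, n)) : Prop :=
  forall i j, is_cderive (fun y => f y i j) x (d i j).

Lemma is_mxderiveP n (f : R -> 'M[R[i]]_n) x d :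
  is_mxderive f x d <-> mxderivable f x /\ mxD f x = d.
Proof.
split=> [fd|[fd <-] i j].
  split=> [i j|]; first by have [[? _] [? _]] := fd i j.
  apply/matrixP => i j; rewrite mxE !derive1E.
  by have [[_ ->] [_ ->]] := fd i j; case: (d i j).
have [fr fi] := fd i j.
by rewrite mxE /= !derive1E; split; exact: derivableP.
Qed.

Lemma is_mxderive_eq m n (f : R -> 'M[R[i]]_(m, n)) x d e :
  is_mxderive f x d -> d = e -> is_mxderive f x e.
Proof. by move=> fd <-. Qed.

Lemma is_mxderive_cst m n (A : 'M[R[i]]_(m, n)) x : is_mxderive (fun=> A) x 0.
Proof. by move=> i j; rewrite mxE; exact: is_cderive_cst. Qed.

Lemma is_mxderiveD m n (f g : R -> 'M[R[i]]_(m, n)) x a b :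
  is_mxderive f x a -> is_mxderive g x b ->
  is_mxderive (fun y => f y + g y) x (a + b).
Proof.
by move=> fa gb i j; under eq_fun do rewrite mxE; rewrite mxE; exact: is_cderiveD.
Qed.

Lemma is_mxderive_tr m n (f : R -> 'M[R[i]]_(m, n)) x a :
  is_mxderive f x a -> is_mxderive (fun y => (f y)^T) x a^T.
Proof. by move=> fa i j; under eq_fun do rewrite mxE; rewrite mxE. Qed.

Lemma is_mxderiveZ m n (f : R -> R[i]) (g : R -> 'M[R[i]]_(m, n)) x a b :
  is_cderive f x a -> is_mxderive g x b ->
  is_mxderive (fun y => f y *: g y) x (a *: g x + f x *: b).
Proof.
move=> fa gb i j; under eq_fun do rewrite mxE; rewrite !mxE.
exact: is_cderiveM.
Qed.

Lemma is_mxderiveM m n p (f : R -> 'M[R[i]]_(m, n)) (g : R -> 'M[R[i]]_(n, p)) x a b :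
  is_mxderive f x a -> is_mxderive g x b ->
  is_mxderive (fun y => f y *m g y) x (a *m g x + f x *m b).
Proof.
move=> fa gb i j; under eq_fun do rewrite mxE.
rewrite !mxE -big_split /=.
by apply: is_cderive_sum => k; exact: is_cderiveM.
Qed.

(* Only the existence of a derivative matters here: its value for the inverse is
   recovered in is_mxderive_inv from f *m invmx f = 1. *)
Lemma cderivable_det n (f : R -> 'M[R[i]]_n) x a :
  is_mxderive f x a -> exists d, is_cderive (fun y => \det (f y)) x d.
Proof.
elim: n f a => [|n IHn] f a fa.
  by exists 0; under eq_fun do rewrite det_mx00; exact: is_cderive_cst.
have cof j : exists d, is_cderive (fun y => cofactor (f y) ord0 j) x d.
  have [|d fd] := IHn (fun y => row' ord0 (col' j (f y))) (row' ord0 (col' j a)).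
    by move=> k l; under eq_fun do rewrite !mxE; rewrite !mxE; exact: fa.
  by eexists; exact: is_cderiveM (is_cderive_cst _ _) fd.
have /choice[d fd] := cof.
exists (\sum_j (a ord0 j * cofactor (f x) ord0 j + f x ord0 j * d j)).
under eq_fun do rewrite (expand_det_row _ ord0).
by apply: is_cderive_sum => j; apply: is_cderiveM.
Qed.

Lemma is_mxderive_inv n (f : R -> 'M[R[i]]_n) x a :
  f x \in unitmx -> is_mxderive f x a ->
  is_mxderive (fun y => invmx (f y)) x (- (invmx (f x) *m a *m invmx (f x))).
Proof.
move=> ux fa; have [d fd] := cderivable_det fa.
have detx : \det (f x) != 0 by move: ux; rewrite unitmxE unitfE.
have unear := is_cderive_near_neq0 detx fd.
have adjd i j : exists e, is_cderive (fun y => (\adj (f y)) i j) x e.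
  rewrite (_ : (fun y => _) = fun y => cofactor (f y) j i); last first.
    by apply/funext => y; rewrite mxE.
  have [|e fe] := @cderivable_det _ (fun y => row' j (col' i (f y))) x
    (row' j (col' i a)).
    by move=> k l; under eq_fun do rewrite !mxE; rewrite !mxE; exact: fa.
  by eexists; exact: is_cderiveM (is_cderive_cst _ _) fe.
pose E := \matrix_(i, j) sval (cid (adjd i j)).
have dadj : is_mxderive (fun y => \adj (f y)) x E.
  by move=> i j; rewrite mxE; exact: svalP.
have [b fb] : exists b, is_mxderive (fun y => invmx (f y)) x b.
  (* The adjugate formula describes [invmx] only where the determinant is nonzero, hence the passage
     to a neighbourhood of [x]. *)
  eexists => i j; apply: near_eq_is_cderive; last first.
    exact: is_mxderiveZ (is_cderiveV detx fd) dadj i j.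
  apply: filterS unear => y dy /=.
  by rewrite /invmx unitmxE unitfE dy.
apply: (is_mxderive_eq fb).
(* Near [x] the product of [f] and its inverse is the constant 1, so its product-rule derivative
   vanishes; solving for [b] gives the value. *)
have d0 : a *m invmx (f x) + f x *m b = 0.
  apply/matrixP => i j.
  apply: is_cderive_unique (is_mxderiveM fa fb i j) _.
  apply: near_eq_is_cderive; last exact: (is_mxderive_cst 1%:M x i j).
  by apply: filterS unear => y dy; rewrite mulmxV ?unitmxE ?unitfE.
move/eqP: d0; rewrite addrC addr_eq0 => /eqP d0.
by rewrite -mulmxA -mulmxN -d0 mulKmx.
Qed.

Lemma near_eq_is_mxderive m n (f g : R -> 'M[R[i]]_(m, n)) x d :
  (\forall y \near x, f y = g y) -> is_mxderive f x d -> is_mxderive g x d.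
Proof.
move=> fg fd i j; apply: near_eq_is_cderive (fd i j).
by apply: filterS fg => y ->.
Qed.

Lemma is_mxderive0_cst m n (f : R -> 'M[R[i]]_(m, n)) :
  (forall x, is_mxderive f x 0) -> forall x y, f x = f y.
Proof.
move=> f0 x y; apply/matrixP => i j; apply: (@is_cderive0_cst _ (fun z => f z i j)) => z.
by have := f0 z i j; rewrite mxE.
Qed.

End MatrixDerivative.

(** * The matrix S, its group and its Lie algebra *)

Section InvariantForm.
Context {R : realType}.
Variables (ty : lie_series) (r : nat).
Notation M := 'M[R[i]]_(r + r).
Notation S := (@Smx R ty r).

(** The symmetry sign of S, through which both series are treated at once. *)
Definition Ssign : R[i] := match ty with C_series => -1 | D_series => 1 end.

Lemma Ssign_sqr : Ssign * Ssign = 1.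
Proof. by rewrite /Ssign; case: ty; rewrite ?mulrNN mul1r. Qed.

Lemma SmxE :
  S = \sum_(k < r) (-1) ^+ k *: (delta_mx (lo k) (hi k) + Ssign *: delta_mx (hi k) (lo k)).
Proof.
apply: eq_bigr => k _; congr (_ *: _); rewrite /Ssign.
by case: ty; rewrite ?scaleN1r ?scale1r.
Qed.

Lemma Smx_tr : S^T = Ssign *: S.
Proof.
rewrite SmxE (raddf_sum (@trmx _ _ _)) scaler_sumr; apply: eq_bigr => k _.
rewrite [LHS]linearZ /= scalerA mulrC -scalerA; congr (_ *: _).
rewrite [LHS]linearD /= linearZ /= !trmx_delta.
by rewrite scalerDr scalerA Ssign_sqr scale1r addrC.
Qed.

Lemma lo_neq_hi (k l : 'I_r) : (lo k == hi l) = false.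
Proof.
apply/eqP => /(congr1 val) /=; have := ltn_ord k; have := ltn_ord l.
by move=> *; lia.
Qed.

Lemma delta_lo_hi_sum :
  \sum_(k < r) (delta_mx (lo k) (lo k) + delta_mx (hi k) (hi k)) = 1%:M :> M.
Proof.
rewrite big_split /= mx1_sum_delta big_split_ord /=; congr (_ + _).
(* [hi] runs through the upper half backwards: r + k = 2r - 1 - (r - 1 - k). *)
rewrite (reindex_inj rev_ord_inj); apply: eq_bigr => k _.
suff -> : hi (rev_ord k) = rshift r k by [].
by apply: val_inj => /=; have := ltn_ord k; lia.
Qed.

(** Only the k-th summand of S has nonzero rows [lo k] and [hi k]. The product type joins both
    equations into one rewriting multirule. *)
Lemma delta_mulSmx (a : 'I_(r + r)) k :
  (delta_mx a (lo k) *m S = (-1) ^+ k *: delta_mx a (hi k)) *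
  (delta_mx a (hi k) *m S = ((-1) ^+ k * Ssign) *: delta_mx a (lo k)).
Proof.
split; rewrite SmxE mulmx_sumr (bigD1 k) //= big1 ?addr0 => [|l nlk].
- rewrite -scalemxAr mulmxDr -scalemxAr !mul_delta_mx_cond eqxx lo_neq_hi.
  by rewrite mulr0n scaler0 addr0.
- rewrite -scalemxAr mulmxDr -scalemxAr !mul_delta_mx_cond lo_neq_hi.
  rewrite (inj_eq (@lshift_inj _ _)) [k == l]eq_sym (negPf nlk).
  by rewrite !mulr0n scaler0 addr0 scaler0.
- rewrite -scalemxAr mulmxDr -scalemxAr !mul_delta_mx_cond eqxx eq_sym lo_neq_hi.
  by rewrite mulr0n add0r scalerA.
- rewrite -scalemxAr mulmxDr -scalemxAr !mul_delta_mx_cond [hi k == _]eq_sym lo_neq_hi.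
  rewrite (inj_eq rev_ord_inj) (inj_eq (@lshift_inj _ _)) [k == l]eq_sym (negPf nlk).
  by rewrite !mulr0n scaler0 addr0 scaler0.
Qed.

Lemma SmxS : S *m S = Ssign%:M.
Proof.
rewrite -scalemx1 -delta_lo_hi_sum scaler_sumr {1}SmxE mulmx_suml.
apply: eq_bigr => k _; rewrite -scalemxAl mulmxDl -scalemxAl !delta_mulSmx.
rewrite !scalerDr !scalerA !mulrA -expr2 sqrr_sign mul1r.
by congr (_ + _ *: _); rewrite mulrAC -expr2 sqrr_sign mul1r.
Qed.

Lemma mulSSt : S *m S^T = 1%:M.
Proof. by rewrite Smx_tr -scalemxAr SmxS scale_scalar_mx Ssign_sqr. Qed.

Lemma Smx_unit : S \in unitmx.
Proof. by have [] := mulmx1_unit mulSSt. Qed.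

Lemma Smx_inv : invmx S = S^T.
Proof. by rewrite -[LHS]mulmx1 -mulSSt mulKmx // Smx_unit. Qed.

(** The form of the group law suited to row vectors multiplied by an inverse on the right, as
    happens to $m_0^T$. *)
Lemma in_group_congr (g : M) : in_group ty g -> invmx g *m S *m (invmx g)^T = S.
Proof.
case=> ug ig; rewrite {1}ig mulmxKV ?Smx_unit // -mulmxA -trmx_mul mulVmx //.
by rewrite trmx1 mulmx1.
Qed.

(** G is the isometry group of the form $S^{-1}$. The equation alone forces invertibility, since it
    exhibits $Sg^TS^{-1}$ as a left inverse; being free of [invmx g], it can be differentiated along
    a flow. *)
Lemma in_groupP (g : M) : in_group ty g <-> g^T *m invmx S *m g = invmx S.
Proof.
have uS := Smx_unit; split=> [[ug ig]|gS].
  have -> : g^T *m invmx S = invmx S *m invmx g.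
    by rewrite ig !mulmxA mulVmx // mul1mx.
  by rewrite mulmxKV.
have invg : S *m g^T *m invmx S *m g = 1%:M 
  by rewrite -(mulmxA S) -mulmxA gS mulmxV.
have [_ ug] := mulmx1_unit invg; split=> //.
by rewrite -[LHS]mul1mx -invg mulmxK.
Qed.

Lemma in_algebraP (X : M) : in_algebra ty X <-> X *m S + S *m X^T = 0.
Proof.
have uS := Smx_unit; rewrite /in_algebra; split=> [H|H].
  by rewrite -[in RHS](mul0mx _ S) -H mulmxDl mulmxKV.
by rewrite -[X in X + _](mulmxK uS) -mulmxDl H mul0mx.
Qed.

Lemma in_algebraD (X Y : M) : in_algebra ty X -> in_algebra ty Y -> in_algebra ty (X + Y).
Proof.
rewrite /in_algebra linearD /= mulmxDr mulmxDl => HX HY.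
by rewrite addrACA HX HY addr0.
Qed.

Lemma in_algebraZ a (X : M) : in_algebra ty X -> in_algebra ty (a *: X).
Proof.
rewrite /in_algebra linearZ /= -scalemxAr -scalemxAl => HX.
by rewrite -scalerDr HX scaler0.
Qed.

Lemma in_algebra0 : in_algebra ty (0 : M).
Proof. by rewrite /in_algebra trmx0 mulmx0 mul0mx addr0. Qed.

Lemma in_algebra_sum (I : Type) (s : seq I) (P : pred I) (F : I -> M) :
  (forall i, in_algebra ty (F i)) -> in_algebra ty (\sum_(i <- s | P i) F i).
Proof. by move=> HF; apply: big_ind => [||i _]; [exact: in_algebra0|exact: in_algebraD|]. Qed.

(** For each basis element H, the matrix HS has the symmetry sign opposite to that of S, whence
    $SH^T=-HS$. *)
Lemma in_algebra_cartan_elt (a : 'I_r -> R) : in_algebra ty (cartan_elt a).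
Proof.
apply: in_algebra_sum => k; apply: in_algebraZ; apply/in_algebraP.
have HS : Hbasis k *m S =
    (-1) ^+ k *: (delta_mx (lo k) (hi k) - Ssign *: delta_mx (hi k) (lo k)).
  by rewrite mulmxBl !delta_mulSmx scalerBr scalerA.
have -> : S *m (Hbasis k)^T = Ssign *: (Hbasis k *m S)^T.
  by rewrite trmx_mul Smx_tr -scalemxAl scalerA Ssign_sqr scale1r.
have -> : (Hbasis k *m S)^T =
    (-1) ^+ k *: (delta_mx (hi k) (lo k) - Ssign *: delta_mx (lo k) (hi k)).
  rewrite HS [LHS]linearZ /=; congr (_ *: _).
  by rewrite [LHS]linearB /= linearZ /= !trmx_delta.
rewrite HS scalerA mulrC -scalerA -scalerDr scalerBr scalerA Ssign_sqr scale1r.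
by rewrite addrC subrKA subrr scaler0.
Qed.

End InvariantForm.

(** * The exponential at zero and linear flows with generator in the Lie algebra *)

Lemma expm0 (R : realType) n : expm (0 : 'M[R[i]]_n) = 1%:M.
Proof.
apply/matrixP => i j; rewrite mxE; apply: (@cvg_lim R[i]^o); first exact: norm_hausdorff.
(* The partial sums equal 1 from index 1 on; the one of index 0 is empty. *)
apply: cvg_near_cst; exists 1%N => // m /= m0.
rewrite -(prednK m0) big_ord_recl /= expr0 invr1 scale1r.
rewrite big1 ?addr0 // => k _.
by rewrite exprS mul0r scaler0.
Qed.

Section Flow.
Context {R : realType}.
Variables (ty : lie_series) (r : nat).
Notation M := 'M[R[i]]_(r + r).
Notation S := (@Smx R ty r).

(** The derivative of $f^TS^{-1}f$ is $f^T(X^TS^{-1}+S^{-1}X)f$, and the bracket vanishes for X in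
    the algebra. *)
Lemma in_group_flow (f X : R -> M) :
  (forall t, is_mxderive f t (X t *m f t)) -> (forall t, in_algebra ty (X t)) ->
  in_group ty (f 0) -> forall t, in_group ty (f t).
Proof.
move=> fX gX /in_groupP g0 t; apply/in_groupP; rewrite -[RHS]g0.
apply: (@is_mxderive0_cst _ _ _ (fun t => (f t)^T *m invmx S *m f t)) => {}t.
have XS : (X t)^T *m invmx S + invmx S *m X t = 0.
  have /(congr1 (mulmx (invmx S))) := gX t.
  by rewrite mulmxDr mulmx0 !mulmxA mulVmx ?Smx_unit // mul1mx addrC.
have dS := is_mxderiveM (is_mxderive_tr (fX t)) (is_mxderive_cst (invmx S) t).
apply: is_mxderive_eq (is_mxderiveM dS (fX t)) _.
rewrite mulmx0 addr0 trmx_mul -!mulmxA -mulmxDr.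
by rewrite (mulmxA (X t)^T) (mulmxA (invmx S) (X t)) -mulmxDl XS mul0mx mulmx0.
Qed.

Lemma solves_ode n (f : R -> 'M[R[i]]_n) U x :
  mxderivable f x -> 'i%C *: mxD f x + U *m f x = 0 ->
  is_mxderive f x (('i%C *: U) *m f x).
Proof.
move=> fx fU; apply/is_mxderiveP; split=> //.
move/eqP: fU; rewrite addr_eq0 => /eqP /(congr1 ( *:%R (- 'i%C))).
by rewrite scalerA mulNr -expr2 sqr_i opprK scale1r scalerN scaleNr opprK -scalemxAl.
Qed.

Lemma in_algebra_Vpot (P : nat) (Vk : 'I_P -> R -> R -> M) fP (Ic : 'I_r -> R) x t z :
  (forall k x t, in_algebra ty (Vk k x t)) ->
  in_algebra ty (Vpot Vk fP (cartan_elt Ic) x t z).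
Proof.
move=> gV; rewrite /Vpot -scaleNr; apply: in_algebraD.
  by apply: in_algebra_sum => k; exact: in_algebraZ.
by apply: in_algebraZ; exact: in_algebra_cartan_elt.
Qed.

End Flow.

(** * Complementary projectors built from two isotropic r-frames *)

Section Projectors.
Context {R : realType}.
Variables (ty : lie_series) (r : nat).
Notation M := 'M[R[i]]_(r + r).
Notation S := (@Smx R ty r).
Variables (n m : 'M[R[i]]_(r + r, r)).
Hypothesis n_isotropic : n^T *m S *m n = 0.
Hypothesis m_isotropic : m^T *m S *m m = 0.
Hypothesis mn_unit : m^T *m n \in unitmx.

Let p : M := n *m invmx (m^T *m n) *m m^T.
Let pm : M := S *m p^T *m invmx S.

Lemma projectorE : p + pm = 1%:M.
Proof.
pose Q := m^T *m n.
pose K : M := row_mx n (S *m m).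
pose L : M := col_mx (invmx Q *m m^T) (invmx Q^T *m n^T *m invmx S).
have LK : L *m K = 1%:M.
  rewrite mul_col_row scalar_mx_block; congr block_mx.
  - by rewrite -mulmxA mulVmx.
  - by rewrite -mulmxA (mulmxA m^T) m_isotropic mulmx0.
  - rewrite Smx_inv Smx_tr -!scalemxAr -scalemxAl -!mulmxA (mulmxA n^T) n_isotropic.
    by rewrite mulmx0 scaler0.
  - rewrite !mulmxA mulmxKV ?Smx_unit // -mulmxA.
    have -> : n^T *m m = Q^T by rewrite trmx_mul trmxK.
    by rewrite mulVmx // unitmx_tr.
(* [K] and [L] are square because each frame has exactly r = N/2 vectors, so the one-sided inverse
   is two-sided. *)
have <- := mulmx1C LK.
have pT : p^T = m *m (invmx Q^T *m n^T).
  by rewrite trmx_mul trmxK trmx_mul trmx_inv.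
by rewrite mul_row_col /pm pT /p -/Q !mulmxA.
Qed.

Lemma projector_idem : p *m p = p.
Proof. by rewrite /p !mulmxA -(mulmxA _ m^T n) mulmxKV. Qed.

(** [p] factors through dimension r, which bounds the rank above; [m^T *m p *m n] equals the
    invertible [m^T *m n], which bounds it below. *)
Lemma projector_rank : \rank p = r.
Proof.
apply/eqP; rewrite eqn_leq; apply/andP; split.
  exact: leq_trans (mxrankM_maxr _ _) (rank_leq_row _).
have rk : \rank (m^T *m p *m n) = r.
  rewrite /p !mulmxA mulmxV // mul1mx; apply/eqP.
  by rewrite -/(row_free _) row_free_unit.
by rewrite -{1}rk; exact: leq_trans (mxrankM_maxl _ _) (mxrankM_maxr _ _).
Qed.

Lemma projector_dual_rank : \rank pm = r.
Proof.
rewrite mxrankMfree ?row_free_unit ?unitmx_inv ?Smx_unit //.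
rewrite -mxrank_tr trmx_mul trmxK mxrankMfree ?projector_rank //.
by rewrite row_free_unit unitmx_tr Smx_unit.
Qed.

End Projectors.

(** * Matrix form of the projector and its derivative in x *)

Section DressingFactor.
Context {R : realType}.
Variables (r : nat).
Notation M := 'M[R[i]]_(r + r).

(** Collecting the vectors as columns of [N] and [m] turns the double sum into the product required
    by the projector and derivative lemmas. *)
Lemma pi1E chip chim lp lm (n0 m0 : 'I_r -> 'cV[R[i]]_(r + r)) x t :
  let N : 'M[R[i]]_(r + r, r) := \matrix_(i, k) n0 k i 0 in
  let m : 'M[R[i]]_(r + r, r) := \matrix_(i, k) m0 k i 0 in
  Rmx chip chim lp lm n0 m0 x t =
    m^T *m invmx (chim x t lm) *m (chip x t lp *m N) /\
  pi1 chip chim lp lm n0 m0 x t =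
    chip x t lp *m N *m invmx (Rmx chip chim lp lm n0 m0 x t) *m
    (m^T *m invmx (chim x t lm)).
Proof.
move=> N m.
have colN k : col k N = n0 k.
  by apply/matrixP => i j; rewrite !mxE (ord1 j).
have rowm k : row k m^T = (m0 k)^T.
  by apply/matrixP => i j; rewrite !mxE (ord1 i).
split.
  apply/matrixP => i k; rewrite mxE -rowm -colN colE.
  transitivity (col k (row i (m^T *m invmx (chim x t lm) *m (chip x t lp *m N))) 0 0).
    by rewrite colE !row_mul !mulmxA.
  by rewrite [LHS]mxE [LHS]mxE.
rewrite /pi1; set Q := invmx _; rewrite [in RHS](matrix_sum_delta Q).
rewrite mulmx_sumr mulmx_suml; apply: eq_bigr => i _.
rewrite mulmx_sumr mulmx_suml; apply: eq_bigr => k _.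
(* Factoring the matrix unit through dimension 1 yields the outer product of column i and row k. *)
rewrite -scalemxAr -scalemxAl -(mul_delta_mx (0 : 'I_1)) -colN -rowm colE rowE.
by rewrite !mulmxA.
Qed.

(** With $a=AN$ and $b=mB^{-1}$ one has $a'=Xa$, $b'=-bY$ and $Q'=b(X-Y)a$; the rule for the inverse
    of Q then gives a Riccati equation. Here [m] stands for the matrix already transposed. *)
Lemma is_mxderive_projector k (A B : R -> M) X Y
    (N : 'M[R[i]]_(r + r, k)) (m : 'M[R[i]]_(k, r + r)) x :
  let Q y := m *m invmx (B y) *m (A y *m N) in
  let p y := A y *m N *m invmx (Q y) *m (m *m invmx (B y)) in
  is_mxderive A x (X *m A x) -> is_mxderive B x (Y *m B x) ->
  B x \in unitmx -> Q x \in unitmx ->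
  is_mxderive p x (X *m p x - p x *m (X - Y) *m p x - p x *m Y).
Proof.
move=> Q p dA dB uB uQ.
have dN : is_mxderive (fun y => A y *m N) x (X *m (A x *m N)).
  apply: is_mxderive_eq (is_mxderiveM dA (is_mxderive_cst N x)) _.
  by rewrite mulmx0 addr0 mulmxA.
have dM : is_mxderive (fun y => m *m invmx (B y)) x (- (m *m invmx (B x) *m Y)).
  apply: is_mxderive_eq (is_mxderiveM (is_mxderive_cst m x) (is_mxderive_inv uB dB)) _.
  by rewrite mul0mx add0r mulmxN !mulmxA mulmxK.
have dQ := is_mxderive_inv uQ (is_mxderiveM dM dN).
apply: is_mxderive_eq (is_mxderiveM (is_mxderiveM dN dQ) dM) _.
rewrite /p; set a := A x *m N; set b := m *m invmx (B x); set Qi := invmx _.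
have -> : - (b *m Y) *m a + b *m (X *m a) = b *m (X - Y) *m a.
  by rewrite mulNmx (mulmxBr b) mulmxBl addrC !mulmxA.
by rewrite !mulmxN mulmxDl mulNmx !mulmxA.
Qed.

End DressingFactor.

(** * Algebra of the dressing equation *)

Section DressingIdentity.
Context {R : realType} {n : nat}.
Implicit Types (p q J d : 'M[R[i]]_n) (lp lm z w : R[i]).

Lemma dressing_identity p q J d lp lm z w :
  w != 0 -> z != lm -> w ^+ 2 = (z - lp) / (z - lm) -> p *m p = p ->
  'i%C *: d = p *m (q - lm *: J) - (q - lp *: J) *m p
              + (lm - lp) *: (p *m J *m p) ->
  let u := w *: p + w^-1 *: (1%:M - p) in
  'i%C *: ((w - w^-1) *: d) + (q + (lm - lp) *: mxcomm J p) *m u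
    - u *m q - z *: mxcomm J u = 0.
Proof.
move=> w0 zlm w2 pp dE u.
have zlm0 : z - lm != 0 by rewrite subr_eq0.
have key : w^-1 * (lm - lp) = (w - w^-1) * (z - lm).
  have -> : lm - lp = (w ^+ 2 - 1) * (z - lm) by rewrite w2; field.
  by field.
have uE : u = w^-1 *: 1%:M + (w - w^-1) *: p.
  by rewrite /u scalerBr scalerBl [LHS]addrCA.
rewrite scalerA mulrC -scalerA dE uE /mxcomm.
rewrite !(mulmxDl, mulmxDr, mulNmx, mulmxN, =^~ scalemxAl, =^~ scalemxAr, mulmx1, mul1mx).
rewrite -(mulmxA J p p) pp.
move: (p *m J *m p) (p *m J) (J *m p) (p *m q) (q *m p) => pJp pJ Jp pq qp.
apply/matrixP => i j; rewrite !mxE.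
(* The terms in q and in pJp cancel, leaving a scalar multiple of [J, p] whose coefficient vanishes
   by [key]. *)
transitivity ((w^-1 * (lm - lp) - (w - w^-1) * (z - lm)) * (Jp i j - pJ i j)); first by ring.
by rewrite key subrr mul0r.
Qed.

(** Brings the Riccati right-hand side to the shape assumed in [dressing_identity]; q cancels from
    [X - Y], so the quadratic term involves J only. *)
Lemma projector_odeE p q J lp lm :
  let X := 'i%C *: (q - lp *: J) in let Y := 'i%C *: (q - lm *: J) in
  'i%C *: (X *m p - p *m (X - Y) *m p - p *m Y) =
  p *m (q - lm *: J) - (q - lp *: J) *m p + (lm - lp) *: (p *m J *m p).
Proof.
move=> X Y; have -> : X - Y = 'i%C *: ((lm - lp) *: J).
  by rewrite /X /Y -scalerBr; congr (_ *: _); apply/matrixP => i j; rewrite !mxE; ring.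
rewrite /X /Y !(=^~ scalemxAl, =^~ scalemxAr) -!scalerBr scalerA -expr2 sqr_i scaleN1r.
move: (p *m _ *m p) (p *m _) (_ *m p) => a b c.
by apply/matrixP => i j; rewrite !mxE; ring.
Qed.

End DressingIdentity.

(** * Group membership of the FAS and of the dressing factor *)

Section LaxSolutions.
Context {R : realType}.
Variables (ty : lie_series) (r : nat).
Notation M := 'M[R[i]]_(r + r).
Notation S := (@Smx R ty r).

(** Membership in G is carried by the t-flow from t = 0, where [chi] and [chi0] agree. The
    x-equation passes from [chi0] to [chi] because the exponential is a right factor constant in x.
    The sign [s] covers both half-planes. *)
Lemma lax_solution_flow (q : R -> R -> M) J (s : R) P (Vk : 'I_P -> R -> R -> M) fP
    (Ic : 'I_r -> R) (chi0 chi : R -> R -> R[i] -> M) z :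
  let I := cartan_elt Ic in
  (forall k x t, in_algebra ty (Vk k x t)) ->
  L0_half_plane_solution ty q J s chi0 -> 0 <= s * complex.Im z ->
  (forall x t,
     chi x t z = chi0 x t z *m expm ((- 'i%C * fP * z ^+ P * t%:C) *: I) /\
     mxderivable (chi x ^~ z) t /\
     'i%C *: mxD (chi x ^~ z) t + Vpot Vk fP I x t z *m chi x t z = 0) ->
  forall x t, in_group ty (chi x t z) /\
    is_mxderive (fun y => chi y t z) x (('i%C *: (q x t - z *: J)) *m chi x t z).
Proof.
move=> I gV [gchi0 ode0 _ _] sz H x t; split.
  apply: (@in_group_flow _ _ _ (chi x ^~ z) (fun t => 'i%C *: Vpot Vk fP I x t z)).
  - by move=> s0; have [_ [? ?]] := H x s0; exact: (@solves_ode _ _ (chi x ^~ z)).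
  - by move=> s0; apply: in_algebraZ; exact: in_algebra_Vpot.
  - by have [-> _] := H x 0; rewrite raddf0 mulr0 scale0r expm0 mulmx1; exact: gchi0.
have -> : (fun y => chi y t z) =
    fun y => chi0 y t z *m expm ((- 'i%C * fP * z ^+ P * t%:C) *: I).
  by apply/funext => y; have [] := H y t.
have [-> _] := H x t; have [d0 e0] := ode0 t z sz x.
have dchi0 := @solves_ode _ _ (fun y => chi0 y t z) _ _ d0 e0.
apply: is_mxderive_eq (is_mxderiveM dchi0 (is_mxderive_cst _ x)) _.
by rewrite mulmx0 addr0 mulmxA.
Qed.

(** The map $X\mapsto SX^TS^{-1}$ exchanges p and 1 - p, so it sends u to the combination with w and
    1/w exchanged, which is the inverse of u. *)
Lemma dressing_in_group (p : M) w : w != 0 -> p *m p = p ->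
  p + S *m p^T *m invmx S = 1%:M -> in_group ty (w *: p + w^-1 *: (1%:M - p)).
Proof.
move=> w0 pp pS; set u := _ + _.
have Sp : S *m p^T *m invmx S = 1%:M - p by rewrite -pS [p + _]addrC addrK.
have Su : S *m u^T *m invmx S = w *: (1%:M - p) + w^-1 *: p.
  rewrite /u linearD /= !linearZ /= linearB /= trmx1.
  rewrite mulmxDr mulmxDl -!scalemxAr -!scalemxAl Sp; congr (_ + _ *: _).
  by rewrite mulmxBr mulmxBl Sp mulmx1 mulmxV ?Smx_unit // subKr.
have uSu : u *m (S *m u^T *m invmx S) = 1%:M.
  rewrite Su /u mulmxDl !mulmxDr -!scalemxAl -!scalemxAr !scalerA mulfV // mulVf //.
  rewrite !mulmxBl !mulmxBr !mulmx1 !mul1mx pp !subrr subr0 !scaler0 !scale1r.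
  by rewrite add0r addr0 addrC subrK.
have [uu _] := mulmx1_unit uSu; split=> //.
by rewrite -[LHS]mulmx1 -uSu mulKmx.
Qed.

End LaxSolutions.

Theorem proposition3 (R : realType) (ty : lie_series) (r : nat)
    (Jc Ic : 'I_r -> R)
    (q : R -> R -> 'M[R[i]]_(r + r))
    (P : nat) (Vk : 'I_P -> R -> R -> 'M[R[i]]_(r + r)) (fP : R[i])
    (chip chim : R -> R -> R[i] -> 'M[R[i]]_(r + r))
    (lp lm : R[i]) (n0 m0 : 'I_r -> 'cV[R[i]]_(r + r))
    (c : R[i] -> R[i]) :
  let J := cartan_elt Jc in
  let I := cartan_elt Ic in
  let p1 := pi1 chip chim lp lm n0 m0 in
  let pm1 := pim1 ty chip chim lp lm n0 m0 in
  let Q1 := q1 q J chip chim lp lm n0 m0 in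
  let u := dressing ty chip chim lp lm n0 m0 c in
  (0 < r)%N ->
  regular ty J ->
  smooth_schwartz q ->
  (forall x t,
     root_span ty (fun a => pos_root ty a \/ neg_root ty a) (q x t)) ->
  (forall k x t, in_algebra ty (Vk k x t)) ->
  lax_compatible q J Vk fP I ->
  lax_FAS ty q J Vk fP I chip chim ->
  0 < complex.Im lp ->
  complex.Im lm < 0 ->
  (forall i k, (m0 i)^T *m Smx ty r *m m0 k = 0 /\
               (n0 i)^T *m Smx ty r *m n0 k = 0) ->
  sqrt_branch lp lm c ->
  forall x t, \det (Rmx chip chim lp lm n0 m0 x t) != 0 ->
  [/\ p1 x t *m p1 x t = p1 x t /\ pm1 x t *m pm1 x t = pm1 x t,
      p1 x t *m pm1 x t = 0 /\ pm1 x t *m p1 x t = 0,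
      \rank (p1 x t) = r /\ \rank (pm1 x t) = r,
      p1 x t + pm1 x t = 1%:M
    & forall z, ~ on_segment lp lm z ->
      [/\ in_group ty (u x t z),
          mxderivable (fun y => u y t z) x
        & 'i%C *: mxD (fun y => u y t z) x + Q1 x t *m u x t z
          - u x t z *m q x t - z *: mxcomm J (u x t z) = 0]].
Proof.
move=> J I p1 pm1 Q1 u _ _ _ _ gV _ [chi0p [chi0m [[solp solm _] Hp Hm]]].
move=> imp imm iso branch x t detR.
have imp0 : 0 <= 1 * complex.Im lp by rewrite mul1r ltW.
have imm0 : 0 <= -1 * complex.Im lm by rewrite mulN1r oppr_ge0 ltW.
have flowp := lax_solution_flow gV solp imp0 (fun y s => Hp y s lp (ltW imp)).
have flowm := lax_solution_flow gV solm imm0 (fun y s => Hm y s lm (ltW imm)).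
pose N : 'M[R[i]]_(r + r, r) := \matrix_(i, k) n0 k i 0.
pose m : 'M[R[i]]_(r + r, r) := \matrix_(i, k) m0 k i 0.
pose A y := chip y t lp; pose B y := chim y t lm.
pose Q y := m^T *m invmx (B y) *m (A y *m N).
have RQ y : Rmx chip chim lp lm n0 m0 y t = Q y by case: (pi1E chip chim lp lm n0 m0 y t).
have p1Q y : p1 y t = A y *m N *m invmx (Q y) *m (m^T *m invmx (B y)).
  by rewrite -RQ; case: (pi1E chip chim lp lm n0 m0 y t).
(* Pairwise isotropy is the vanishing of the Gram matrix of the frame. *)
have gram (v : 'I_r -> 'cV[R[i]]_(r + r)) : (forall i k, (v i)^T *m Smx ty r *m v k = 0) ->
    (\matrix_(i, k) v k i 0)^T *m Smx ty r *m (\matrix_(i, k) v k i 0) = 0.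
  move=> v0; apply/row_matrixP => i; apply/matrixP => a k.
  have colv l : col l (\matrix_(i, k) v k i 0) = v l.
    by apply/matrixP => b b'; rewrite !mxE (ord1 b').
  transitivity (col k (row i ((\matrix_(i, k) v k i 0)^T *m Smx ty r
                  *m \matrix_(i, k) v k i 0)) a 0); first by rewrite [RHS]mxE.
  by rewrite colE !row_mul -tr_col -mulmxA -colE !colv v0 !mxE.
(* Stated for all [y], not only at [x]: differentiating [u] requires the complementarity of the
   projectors on a neighbourhood. *)
have proj y : Q y \in unitmx ->
    [/\ p1 y t *m p1 y t = p1 y t, \rank (p1 y t) = r, \rank (pm1 y t) = r
      & p1 y t + pm1 y t = 1%:M].
  move=> uQ; have [gA _] := flowp y t; have [gB _] := flowm y t.
  pose n' := A y *m N; pose m' := (invmx (B y))^T *m m.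
  have m'T : m'^T = m^T *m invmx (B y) by rewrite trmx_mul trmxK.
  have n'0 : n'^T *m Smx ty r *m n' = 0.
    have /in_groupP gA' := gA; move: gA'.
    (* Since $S^{-1}$ is S up to sign, invariance of the one form is invariance of the other. *)
    rewrite Smx_inv Smx_tr -scalemxAr -scalemxAl => /(congr1 ( *:%R (Ssign ty))).
    rewrite !scalerA Ssign_sqr !scale1r => gA'.
    rewrite trmx_mul -!mulmxA (mulmxA (A y)^T) (mulmxA _ (A y) N) gA'.
    by rewrite mulmxA gram // => i k; case: (iso i k).
  have m'0 : m'^T *m Smx ty r *m m' = 0.
    rewrite m'T -!mulmxA (mulmxA (invmx (B y))) (mulmxA _ _^T m) in_group_congr //.
    by rewrite mulmxA gram // => i k; case: (iso i k).
  have mn : m'^T *m n' \in unitmx by rewrite m'T.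
  have p1E : p1 y t = n' *m invmx (m'^T *m n') *m m'^T by rewrite p1Q m'T.
  have pm1E : pm1 y t = Smx ty r *m (p1 y t)^T *m invmx (Smx ty r) by [].
  rewrite pm1E p1E; split.
  - exact: projector_idem.
  - exact: projector_rank.
  - exact: projector_dual_rank.
  - exact: projectorE.
have uQ : Q x \in unitmx by rewrite unitmxE unitfE -RQ.
have [pp rp rpm pD] := proj x uQ.
have pmE : pm1 x t = 1%:M - p1 x t by rewrite -pD [p1 x t + _]addrC addrK.
split=> //.
- by split=> //; rewrite pmE mulmxBl mul1mx mulmxBr mulmx1 pp subrr subr0.
- by split; rewrite pmE ?mulmxBl ?mul1mx ?mulmxBr ?mulmx1 pp subrr.
move=> z zseg; have [c2 _ _] := branch.
(* The endpoints [lp] and [lm] lie on the segment, at parameters 1 and 0; avoiding both makes [c z]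
   nonzero. *)
have zlp : z != lp.
  apply/eqP => zE; apply: zseg; exists 1; first by rewrite lexx ler01.
  by rewrite zE rmorph1 mul1r addrC subrK.
have zlm : z != lm.
  apply/eqP => zE; apply: zseg; exists 0; first by rewrite lexx ler01.
  by rewrite zE rmorph0 mul0r addr0.
have c0 : c z != 0.
  apply/eqP => cz; have /esym/eqP := c2 z zseg.
  by rewrite cz expr0n mulf_eq0 invr_eq0 !subr_eq0 (negPf zlp) (negPf zlm).
have uE y : Q y \in unitmx ->
    u y t z = c z *: p1 y t + (c z)^-1 *: (1%:M - p1 y t).
  case/proj=> _ _ _ pDy; rewrite /u /dressing -/(p1 y t) -/(pm1 y t).
  have -> : pm1 y t = 1%:M - p1 y t by rewrite -pDy [p1 y t + _]addrC addrK.
  by move: (p1 y t) => p; apply/matrixP => i j; rewrite !mxE; ring.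
have [[_ dA] [gB dB]] := (flowp x t, flowm x t).
have uB : B x \in unitmx by case: gB.
pose X := 'i%C *: (q x t - lp *: J); pose Y := 'i%C *: (q x t - lm *: J).
pose d := X *m p1 x t - p1 x t *m (X - Y) *m p1 x t - p1 x t *m Y.
have dp : is_mxderive (fun y => p1 y t) x d.
  have := is_mxderive_projector dA dB uB uQ; rewrite /= -/(Q x) -p1Q.
  by congr is_mxderive; apply/funext => y; rewrite p1Q.
(* The determinant of [Q] is differentiable at [x] and nonzero there, so the expression of [u]
   through [p1] alone holds near [x] and may be differentiated. *)
have near_unit : \forall y \near x, Q y \in unitmx.
  have dQ := is_mxderiveM (is_mxderiveM (is_mxderive_cst m^T x) (is_mxderive_inv uB dB))
    (is_mxderiveM dA (is_mxderive_cst N x)).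
  have [e de] := cderivable_det dQ.
  have detQ : \det (Q x) != 0 by rewrite -RQ.
  have := is_cderive_near_neq0 detQ de.
  by apply: filterS => y; rewrite unitmxE unitfE.
have near_u : \forall y \near x,
    (c z)^-1 *: 1%:M + (c z - (c z)^-1) *: p1 y t = u y t z.
  apply: filterS near_unit => y /uE ->.
  by rewrite scalerBr scalerBl [RHS]addrCA.
have du : is_mxderive (fun y => u y t z) x ((c z - (c z)^-1) *: d).
  apply: near_eq_is_mxderive near_u _.
  apply: is_mxderive_eq
    (is_mxderiveD (is_mxderive_cst _ x) (is_mxderiveZ (is_cderive_cst _ x) dp)) _.
  by rewrite add0r scale0r add0r.
have /is_mxderiveP[du1 du2] := du.
split=> //.
  by rewrite uE //; exact: dressing_in_group.
rewrite du2 uE //; apply: dressing_identity => //; first exact: c2.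
exact: projector_odeE.
Qed.
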